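(* Let $(x_k)_{k\in\mathbb{N}}$ and $(\beta_k)_{k\in\mathbb{N}}$ be (infinite) sequences generated by the IPG-ELS method applied to $\min_{x\in\mathbb{E}} F(x)=f(x)+g(x)$. Assume that there exists $\beta>0$ such that $\beta_k\ge\beta$ for all $k\in\mathbb{N}$. Then, for all $k\in\mathbb{N}$, $$F(x_k)-F_*\le\frac{\mathrm{dist}(x_0,S_* )^2+2\left(F(x_0)-F_*\right)}{2\beta(k+1)}.$$
   Context: Setting. $\mathbb{N}=\{0,1,2,\dots\}$. $\mathbb{E}$ is a finite-dimensional Euclidean space with inner product $\langle\cdot,\cdot\rangle$ and norm $\|\cdot\|=\sqrt{\langle\cdot,\cdot\rangle}$; $g:\mathbb{E}\to\mathbb{R}\cup\{+\infty\}$ is proper, lower semicontinuous and convex; $f:\mathbb{E}\to\mathbb{R}$ is continuously differentiable and convex. $F:=f+g$, $F_*$ is the optimal value of $\min_{x\in\mathbb{E}}F(x)$ and $S_*$ its set of minimizers; it is assumed that $S_*\neq\emptyset$. $\mathrm{dist}(x_0,S_* )=\inf_{x\in S_*}\|x_0-x\|$. $\mathrm{dom}\,g=\{x: g(x)<+\infty\}$. For $\varepsilon\ge 0$ and $x\in\mathrm{dom}\,g$, $\partial_\varepsilon g(x):=\{v\in\mathbb{E}: g(y)\ge g(x)+\langle v,y-x\rangle-\varepsilon\ \ \forall y\in\mathbb{E}\}$, and $\partial_\varepsilon g(x)=\emptyset$ if $x\notin\mathrm{dom}\,g$. IPG-ELS method (Inexact Proximal Gradient method with an Explicit Linesearch).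 Parameters: $x_0\in\mathrm{dom}\,g$, $\tau\in(0,1]$, $\theta\in(0,1)$, $\gamma_1>1$, $\gamma_2\ge 1$, $\alpha\in[0,1-\tau]$. Set $k=0$. Step 2: find any triple $(\tilde x_k,v_k,\varepsilon_k)\in\mathbb{E}\times\mathbb{E}\times[0,\infty)$ such that $$v_k\in\nabla f(x_k)+\partial_{\varepsilon_k}g(\tilde x_k)+\tilde x_k-x_k,$$ $$g(\tilde x_k-v_k)-g(\tilde x_k)-\langle\nabla f(x_k),v_k\rangle+\tfrac{1+\gamma_1}{2}\|v_k\|^2+(1+\gamma_2)\varepsilon_k\le\tfrac{1-\tau-\alpha}{2}\|x_k-\tilde x_k\|^2.$$ Step 3: if $\tilde x_k=x_k$, stop. Step 4 (linesearch): put $y_k:=\tilde x_k-v_k$ and start with $\beta=1$. If $$f(x_k+\beta(y_k-x_k))\le f(x_k)+\beta\langle\nabla f(x_k),y_k-x_k\rangle+\tfrac{\beta\tau}{2}\|x_k-\tilde x_k\|^2+\tfrac{\gamma_1}{2}\beta\|v_k\|^2+\beta\gamma_2\varepsilon_k,$$ set $\beta_k=\beta$, $x_{k+1}=x_k+\beta_k(y_k-x_k)$, $k:=k+1$ and return to Step 2; otherwise replace $\beta$ by $\theta\beta$ and test the inequality again. *)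

(* Defs.v *)
From HB Require Import structures.
From mathcomp Require Import all_boot all_order all_algebra.
From mathcomp Require Import all_classical all_reals all_analysis.

Set Implicit Arguments.
Unset Strict Implicit.
Unset Printing Implicit Defensive.

Import Order.TTheory GRing.Theory Num.Theory.
Import numFieldNormedType.Exports.

Local Open Scope classical_set_scope.
Local Open Scope ring_scope.

(* The norm of [E], hence its topology, is required to be the one induced by
   the inner product; [Vector] makes [E] finite-dimensional.  The library's
   norm on ['rV_n] is the sup norm, so ['rV_n] itself is not an instance. *)
HB.mixin Record isEuclidean (R : realType) E
    & NormedModule R E & Vector R E := {
  inner : E -> E -> R ;
  innerC : forall x y : E, inner x y = inner y x ;
  innerDl : forall x y z : E, inner (x + y) z = inner x z + inner y z ;
  innerZl : forall (a : R) (x y : E), inner (a *: x) y = a * inner x y ;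
  inner_gt0 : forall x : E, x != 0 -> 0 < inner x x ;
  norm_inner : forall x : E, `|x| = Num.sqrt (inner x x)
}.

#[short(type="euclideanType")]
HB.structure Definition Euclidean (R : realType) :=
  {E of NormedModule R E & Vector R E & isEuclidean R E}.

Section convex_analysis.
Context {R : realType} {E : euclideanType R}.
Implicit Types (f : E -> R) (g F : E -> \bar R) (x y v : E) (S : set E).

(* The Riesz representative of ['d f x], unique when [f] is differentiable
   at [x] and unspecified otherwise. *)
Definition gradient f x : E :=
  get [set w | forall h : E, 'd f x h = inner w h].

Definition continuously_differentiable f : Prop :=
  (forall x, differentiable f x) /\ continuous (gradient f).

Definition effective_domain g : set E := [set x | (g x < +oo)%E].

Definition proper_function g : Prop :=
  (forall x, (-oo < g x)%E) /\ effective_domain g !=set0.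

(* [0 * +oo = 0] in [\bar R], so the cases [t = 0] and [t = 1] are harmless. *)
Definition econvex g : Prop :=
  forall x y (t : R), 0 <= t <= 1 ->
    (g (t *: x + (1 - t) *: y)%R <= t%:E * g x + (1 - t)%:E * g y)%E.

Definition eps_subdifferential (eps : R) g x : set E :=
  [set v | effective_domain g x /\
    forall y, (g x + (inner v (y - x))%:E - eps%:E <= g y)%E].

Definition minimizers F : set E := [set x | forall y, (F x <= F y)%E].

Definition optimal_value F : \bar R := ereal_inf (range F).

(* Only meaningful for [S] nonempty: [inf set0 = 0]. *)
Definition distance_to x S : R := inf [set `|x - s| | s in S].

End convex_analysis.

Section ipg_els.
Context {R : realType} {E : euclideanType R}.
Variables (f : E -> R) (g : E -> \bar R).
Variables (tau theta gamma1 gamma2 alpha : R).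

Definition objective (x : E) : \bar R := ((f x)%:E + g x)%E.

Definition inexact_prox_step (x xt v : E) (eps : R) : Prop :=
  [/\ 0 <= eps,
      [set gradient f x + u + xt - x | u in eps_subdifferential eps g xt] v &
      (g (xt - v)%R - g xt - (inner (gradient f x) v)%:E
         + ((1 + gamma1) / 2 * `|v| ^+ 2)%:E + ((1 + gamma2) * eps)%:E
       <= ((1 - tau - alpha) / 2 * `|x - xt| ^+ 2)%:E)%E].

Definition linesearch_test (x xt v : E) (eps beta : R) : bool :=
  let y := xt - v in
  f (x + beta *: (y - x)) <=
    f x + beta * inner (gradient f x) (y - x)
    + beta * tau / 2 * `|x - xt| ^+ 2
    + gamma1 / 2 * beta * `|v| ^+ 2 + beta * gamma2 * eps.

(* The backtracking loop started at 1 returns the first [theta ^+ j] passing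
   the test. *)
Definition linesearch_output (x xt v : E) (eps beta : R) : Prop :=
  exists j : nat,
    [/\ beta = theta ^+ j,
        linesearch_test x xt v eps (theta ^+ j) &
        forall i : nat, (i < j)%N -> ~~ linesearch_test x xt v eps (theta ^+ i)].

(* An infinite run: the stopping test [xt k = x k] never succeeds. *)
Definition generated_by_ipg_els (x : nat -> E) (beta : nat -> R) : Prop :=
  effective_domain g (x 0%N) /\
  exists (xt v : nat -> E) (eps : nat -> R), forall k : nat,
    [/\ inexact_prox_step (x k) (xt k) (v k) (eps k),
        xt k <> x k,
        linesearch_output (x k) (xt k) (v k) (eps k) (beta k) &
        x k.+1 = x k + beta k *: ((xt k - v k) - x k)].

End ipg_els.

(* Main.v *)
From HB Require Import structures.
Require Import Defs.
From mathcomp Require Import all_boot all_order all_algebra.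
From mathcomp Require Import all_classical all_reals all_analysis.
From mathcomp Require Import ring lra.

(**
The idea is that one step of the method, compared with an arbitrary point [z],
behaves like an exact proximal step relaxed by the factor [b := beta_ k].
Write [x], [xt], [v], [eps] for the data of step [k], [y := xt - v] for the
trial point and [x' := x + b (y - x)] for the next iterate.

The linesearch test bounds [f x'] by [(1 - b) f x + b m], where [m] is the
linear model of [f] at [x] taken at [y] plus the error terms in [|x - xt|^2],
[|v|^2] and [eps]; convexity bounds [g x'] by [(1 - b) g x + b g y]. The
inexactness criterion of the prox step is made so that, after it replaces
[g y] by [g xt], the terms with [gamma1] and [gamma2] cancel and at most
[|x - xt|^2 / 2 - |v|^2 / 2 - eps] survives. The inclusion for [v] says that
[x - y - grad f x] is an [eps]-subgradient of [g] at [xt], which compares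
[g xt] with [g z] and absorbs the [- eps]; the gradient inequality compares the
linear model of [f] with [f z]. What is left is exactly the right-hand side of
an identity between squared distances ([sqr_norm_three_point]), whence
  [m + g y <= F z + (|x - z|^2 - |y - z|^2) / 2].
Multiplying by [b] and writing [|x' - z|^2] by [sqr_norm_convex_comb] gives
[ipg_els_step_le]:
  [2 (F x' - F z) + |x' - z|^2 <= 2 (1 - b) (F x - F z) + |x - z|^2].

With [z = x] this says that [F] does not increase along the run. With [z] a minimizer
it bounds [2 b (F x - F z)] by the decrease of [2 (F x - F z) + |x - z|^2], so
the sum over the steps telescopes, and monotonicity turns the bound on the sum
into a bound on its last term ([telescoping_rate]). Taking the infimum over
the minimizers produces the distance to the solution set
([sqr_distance_ge]).

The gradient is defined as the Riesz representative of the differential, so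
the inner products with it are meaningful only after representatives are shown
to exist ([riesz_representation]).
*)

Set Implicit Arguments.
Unset Strict Implicit.
Unset Printing Implicit Defensive.

Import Order.TTheory GRing.Theory Num.Theory.
Import numFieldNormedType.Exports.

Local Open Scope classical_set_scope.
Local Open Scope ring_scope.

(** * Inner products, the Riesz representation and the gradient *)

Section inner_product.
Context {R : realType} {E : euclideanType R}.
Implicit Types x y z w : E.

Lemma innerDr x y z : inner x (y + z) = inner x y + inner x z.
Proof. by rewrite innerC innerDl !(innerC _ x). Qed.

Lemma innerZr a x y : inner x (a *: y) = a * inner x y.
Proof. by rewrite innerC innerZl innerC. Qed.

Lemma inner0l x : inner 0 x = 0.
Proof. by rewrite -(scale0r x) innerZl mul0r. Qed.

Lemma inner0r x : inner x 0 = 0.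
Proof. by rewrite innerC inner0l. Qed.

Lemma innerNl x y : inner (- x) y = - inner x y.
Proof. by rewrite -scaleN1r innerZl mulN1r. Qed.

Lemma innerNr x y : inner x (- y) = - inner x y.
Proof. by rewrite innerC innerNl innerC. Qed.

Definition inner_linE :=
  (@innerDl R E, innerDr, innerNl, innerNr, @innerZl R E, innerZr).

Lemma inner_sumr x (I : Type) (r : seq I) (F : I -> E) :
  inner x (\sum_(i <- r) F i) = \sum_(i <- r) inner x (F i).
Proof. exact: (big_morph _ (innerDr x) (inner0r x)). Qed.

Lemma inner_ge0 x : 0 <= inner x x.
Proof.
by have [->|/inner_gt0/ltW//] := eqVneq x 0; rewrite inner0l.
Qed.

Lemma sqr_norm_inner x : `|x| ^+ 2 = inner x x.
Proof. by rewrite norm_inner sqr_sqrtr// inner_ge0. Qed.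

(** In a basis [e], the map [w |-> \sum_i <w, e_i> e_i] is injective, because a
    vector orthogonal to the whole basis is orthogonal to itself; being an
    endomorphism of a finite-dimensional space it is then surjective, and a
    preimage of [\sum_i phi(e_i) e_i] represents [phi]. *)
Lemma riesz_representation (phi : {linear E -> R^o}) :
  exists w : E, forall h : E, phi h = inner w h.
Proof.
pose e := vbasis {:E}.
have e_basis : basis_of {:E} e by exact: vbasisP.
have decomp h : h = \sum_i coord e i h *: e`_i.
  by apply: coord_vbasis; rewrite memvf.
pose T w : E := \sum_(i < \dim {:E}) inner w e`_i *: e`_i.
have T_lin : linear T.
  move=> a u w; rewrite /T scaler_sumr -big_split/=; apply: eq_bigr => i _.
  by rewrite innerDl innerZl scalerDl scalerA.
pose TL : {linear E -> E} := HB.pack T (GRing.isLinear.Build R E E _ T T_lin).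
have T_inj : lker (linfun TL) == 0%VS.
  rewrite -subv0; apply/subvP => w; rewrite memv_ker memv0 lfunE/= => /eqP Tw0.
  have w_e (i : 'I_(\dim {:E})) : inner w e`_i = 0.
    have /freeP := basis_free e_basis.
    by move=> /(_ (fun i => inner w e`_i) Tw0 i).
  have ww0 : inner w w = 0.
    rewrite {2}(decomp w) inner_sumr big1// => i _.
    by rewrite innerZr w_e mulr0.
  by apply/negPn/negP => /inner_gt0; rewrite ww0 ltxx.
pose w := ((linfun TL)^-1)%VF (\sum_(i < \dim {:E}) phi e`_i *: e`_i).
have Tw : T w = \sum_(i < \dim {:E}) phi e`_i *: e`_i.
  have := lker0_lfunVK T_inj (\sum_(i < \dim {:E}) phi e`_i *: e`_i).
  by rewrite lfunE.
exists w => h; rewrite (decomp h) linear_sum inner_sumr; apply: eq_bigr => i _.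
rewrite linearZ innerZr; congr (_ * _).
apply/esym/eqP; rewrite -subr_eq0; apply/eqP.
have /freeP := basis_free e_basis.
move=> /(_ (fun i => inner w e`_i - phi e`_i)); apply.
rewrite -[RHS](subrr (T w)) {2}Tw /T -sumrB.
by apply: eq_bigr => j _; rewrite scalerBl.
Qed.

Lemma gradientP (f : E -> R) x : forall h, 'd f x h = inner (gradient f x) h.
Proof.
have [w ww] := riesz_representation ('d f x).
exact: (@getPex _ [set w | forall h : E, 'd f x h = inner w h] (ex_intro _ w ww)).
Qed.

(** On the segment from [x] to [z], convexity bounds every forward difference
    quotient [(f (x + h (z - x)) - f x) / h] with [0 < h <= 1] by [f z - f x];
    the derivative is their limit as [h] tends to 0 from the right. *)
Lemma convex_gradient_le (f : E -> R) x z :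
  convex_function [set: convex_lmodType E] f -> differentiable f x ->
  f x + inner (gradient f x) (z - x) <= f z.
Proof.
move=> f_cvx f_diff; rewrite -gradientP -deriveE// addrC -lerBrDr.
have f_der := diff_derivable (v := z - x) f_diff.
rewrite /derive cvg_at_rightE//; apply: limr_le.
  exact: cvgP (cvg_dnbhs_at_right f_der).
near=> h.
have h0 : 0 < h by [].
have h1 : h <= 1 by near: h; exact: nbhs_right_le.
have hi : 0 <= h <= 1 by rewrite (ltW h0).
rewrite /= [_ *: _]mulrC ler_pdivrMr//.
have := f_cvx (Itv01 (ltW h0) h1) z x.
rewrite !in_setT => /(_ isT isT); rewrite !convRE /=.
rewrite /conv/= /unstable.onem /=.
have -> : h *: z + (1 - h) *: x = h *: (z - x) + x.
  by rewrite scalerBr scalerBl scale1r addrCA [RHS]addrC.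
move=> ?; rewrite /shift/=; nra.
Unshelve. all: by end_near. Qed.

(** The first term comes from the subgradient inequality, and [- |v|^2] is
    [- |xt - y|^2] for [y = xt - v]: the two residuals [|x - xt|^2] and [|v|^2]
    are precisely what turns the inner product into a difference of squared
    distances to [z]. *)
Lemma sqr_norm_three_point x xt v z :
  2 * inner (x - (xt - v)) (xt - z) + `|x - xt| ^+ 2 - `|v| ^+ 2 =
  `|x - z| ^+ 2 - `|xt - v - z| ^+ 2.
Proof.
rewrite !sqr_norm_inner !inner_linE ?(innerC v x) ?(innerC v xt) ?(innerC v z).
rewrite ?(innerC xt x) ?(innerC z x) ?(innerC xt z); ring.
Qed.

Lemma sqr_norm_convex_comb x y z (b : R) :
  `|x + b *: (y - x) - z| ^+ 2 =
  (1 - b) * `|x - z| ^+ 2 + b * `|y - z| ^+ 2 - b * (1 - b) * `|x - y| ^+ 2.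
Proof.
rewrite !sqr_norm_inner !inner_linE ?(innerC y x) ?(innerC z x) ?(innerC z y).
ring.
Qed.

(** The infimum defining [distance_to] is outside the square, so the bound is
    passed to it through [Num.sqrt c]; a nonpositive [c] is a separate case. *)
Lemma sqr_distance_ge x (S : set E) (c : R) :
  S !=set0 -> (forall s, S s -> c <= `|x - s| ^+ 2) ->
  c <= distance_to x S ^+ 2.
Proof.
move=> [s0 Ss0] c_le.
have d_ge (a : R) : (forall s, S s -> a <= `|x - s|) -> a <= distance_to x S.
  move=> a_le; apply: lb_le_inf; first by exists `|x - s0|, s0.
  by move=> _ [s Ss <-]; exact: a_le.
have [c0|c0] := leP c 0; first exact: le_trans c0 (sqr_ge0 _).
rewrite -(sqr_sqrtr (ltW c0)) lerXn2r ?nnegrE ?sqrtr_ge0//.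
  by apply: d_ge.
apply: d_ge => s Ss; rewrite -(ler_pXn2r (n := 2)) ?nnegrE ?sqrtr_ge0//.
by rewrite sqr_sqrtr ?(ltW c0)// c_le.
Qed.

End inner_product.

(** * One step of the method *)

(** The objective as a real number; it agrees with [objective f g] only on the
    effective domain of [g], where all the iterates are. *)
Definition fin_objective (R : realType) (E : euclideanType R)
    (f : E -> R) (g : E -> \bar R) (w : E) : R := f w + fine (g w).

Section ipg_els_step.
Context {R : realType} {E : euclideanType R}.
Implicit Types (f : E -> R) (g : E -> \bar R) (x xt v z w : E).

Lemma proper_fineK g w :
  proper_function g -> effective_domain g w -> (fine (g w))%:E = g w.
Proof.
by move=> [g_gtNy _] gw; rewrite fineK// fin_numElt gw andbT.
Qed.

Lemma objective_finE f g w : proper_function g -> effective_domain g w ->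
  objective f g w = (fin_objective f g w)%:E.
Proof. by move=> g_proper gw; rewrite /objective -(proper_fineK g_proper gw). Qed.

(** The inclusion for [v] makes [g xt] finite; the inexactness criterion then
    bounds [g (xt - v)] from above by a real number. *)
Lemma inexact_prox_step_dom f g tau gamma1 gamma2 alpha x xt v eps :
  proper_function g ->
  inexact_prox_step f g tau gamma1 gamma2 alpha x xt v eps ->
  effective_domain g xt /\ effective_domain g (xt - v).
Proof.
move=> g_proper [_ [u [dom_xt _] _] step]; split => //.
rewrite /effective_domain/= ltey; apply/eqP => gy.
by move: step; rewrite gy -(proper_fineK g_proper dom_xt).
Qed.

(** The estimate that drives the proof; the two uses of it are [z := x], for
    monotonicity, and [z] a minimizer, for the rate. *)
Lemma ipg_els_step_le f g tau gamma1 gamma2 alpha x xt v eps beta z :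
  proper_function g -> econvex g ->
  differentiable f x -> convex_function [set: convex_lmodType E] f ->
  0 <= alpha -> 0 <= beta <= 1 ->
  inexact_prox_step f g tau gamma1 gamma2 alpha x xt v eps ->
  linesearch_test f tau gamma1 gamma2 x xt v eps beta ->
  effective_domain g x -> effective_domain g z ->
  let x' := x + beta *: (xt - v - x) in
  effective_domain g x' /\
  2 * (fin_objective f g x' - fin_objective f g z) + `|x' - z| ^+ 2 <=
    2 * (1 - beta) * (fin_objective f g x - fin_objective f g z)
    + `|x - z| ^+ 2.
Proof.
move=> g_proper g_convex f_diff f_cvx alpha0 beta01 step test dom_x dom_z x'.
have [dom_xt dom_y] := inexact_prox_step_dom g_proper step.
have gx'_le : (g x' <=
    (beta * fine (g (xt - v)) + (1 - beta) * fine (g x))%:E)%E.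
  have -> : x' = beta *: (xt - v) + (1 - beta) *: x.
    by rewrite /x' scalerBr scalerBl scale1r addrCA.
  apply: le_trans (g_convex _ _ _ beta01) _.
  by rewrite -(proper_fineK g_proper dom_y) -(proper_fineK g_proper dom_x)
    -!EFinM -EFinD.
have dom_x' : effective_domain g x' by exact: le_lt_trans gx'_le (ltry _).
split=> //; move: gx'_le; rewrite -(proper_fineK g_proper dom_x') lee_fin => gx'_le.
have [_ [u [_ /(_ z) +] uE] +] := step.
rewrite -(proper_fineK g_proper dom_y) -(proper_fineK g_proper dom_xt).
rewrite -(proper_fineK g_proper dom_z).
rewrite -!(EFinD, EFinB) !lee_fin => gz_ge gy_le.
(* That is, [u = x - (xt - v) - gradient f x]. *)
have u_inner : inner u (z - xt) = - inner (x - (xt - v)) (xt - z) -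
    (inner (gradient f x) z - inner (gradient f x) xt).
  by rewrite -uE !inner_linE; ring.
move: test; rewrite /linesearch_test -/x' => test.
have model_le :
    f x + inner (gradient f x) (xt - v - x) + fine (g (xt - v))
      + tau / 2 * `|x - xt| ^+ 2 + gamma1 / 2 * `|v| ^+ 2 + gamma2 * eps <=
    fin_objective f g z + (`|x - z| ^+ 2 - `|xt - v - z| ^+ 2) / 2.
  have := convex_gradient_le z f_cvx f_diff.
  have alphaP : 0 <= alpha * `|x - xt| ^+ 2 by rewrite mulr_ge0 ?sqr_ge0.
  have := sqr_norm_three_point x xt v z.
  move: gz_ge gy_le; rewrite u_inner /fin_objective.
  rewrite !(innerDr (gradient f x)) !(innerNr (gradient f x)).
  by move=> *; lra.
have /andP[beta0 beta1] := beta01.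
have := ler_wpM2l beta0 model_le.
have : 0 <= beta * (1 - beta) * `|x - (xt - v)| ^+ 2.
  by rewrite !mulr_ge0 ?sqr_ge0 ?subr_ge0.
rewrite (sqr_norm_convex_comb x (xt - v) z beta) /fin_objective -/x'.
by move=> *; lra.
Qed.

End ipg_els_step.

(** * Summation over the steps *)

(** The recurrence says that [2 b_k a_k] is at most the decrease of the
    potential [2 a + d]; since [a] is nonincreasing, the sum of its first
    [k + 1] terms is at least [k + 1] times [a k]. *)
Lemma telescoping_rate (R : realFieldType) (a d b : nat -> R) (beta : R) :
  0 <= beta -> (forall k, 0 <= a k) -> (forall k, 0 <= d k) ->
  (forall k, a k.+1 <= a k) -> (forall k, beta <= b k) ->
  (forall k, 2 * a k.+1 + d k.+1 <= 2 * (1 - b k) * a k + d k) ->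
  forall k, 2 * beta * k.+1%:R * a k <= d 0%N + 2 * a 0%N.
Proof.
move=> beta0 a0 d0 a_dec b_ge step k.
have sum_le : 2 * beta * (\sum_(i < k.+1) a i) + 2 * a k.+1 + d k.+1 <=
    d 0%N + 2 * a 0%N.
  elim: k => [|k IH].
    rewrite big_ord1; have := step 0%N; have := ler_wpM2r (a0 0%N) (b_ge 0%N).
    by move=> *; lra.
  rewrite big_ord_recr/=.
  have := step k.+1; have := ler_wpM2r (a0 k.+1) (b_ge k.+1).
  by move=> *; lra.
have sum_ge : k.+1%:R * a k <= \sum_(i < k.+1) a i.
  rewrite mulr_natl -[k.+1 in leLHS]card_ord -sumr_const.
  apply: ler_sum => i _; have a_homo := homo_leq lexx ge_trans a_dec.
  by apply: a_homo; rewrite -ltnS.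
rewrite -mulrA; apply: le_trans sum_le.
have := ler_wpM2l beta0 sum_ge; have := a0 k.+1; have := d0 k.+1.
by move=> *; lra.
Qed.

Theorem theorem5p2 (R : realType) (E : euclideanType R)
    (f : E -> R) (g : E -> \bar R)
    (g_proper : proper_function g) (g_lsc : lower_semicontinuous g)
    (g_convex : econvex g)
    (f_C1 : continuously_differentiable f)
    (f_convex : convex_function [set: convex_lmodType E] f)
    (F_argmin : minimizers (objective f g) !=set0)
    (tau theta gamma1 gamma2 alpha : R)
    (tau_itv : 0 < tau <= 1) (theta_itv : 0 < theta < 1)
    (gamma1_gt1 : 1 < gamma1) (gamma2_ge1 : 1 <= gamma2)
    (alpha_itv : 0 <= alpha <= 1 - tau)
    (x : nat -> E) (beta_ : nat -> R)
    (x_gen : generated_by_ipg_els f g tau theta gamma1 gamma2 alpha x beta_)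
    (beta : R) (beta_gt0 : 0 < beta) (beta_le : forall k, beta <= beta_ k) :
  let F := objective f g in
  let Fstar := optimal_value F in
  forall k : nat,
    (F (x k) - Fstar <=
     ((distance_to (x 0%N) (minimizers F) ^+ 2)%:E + 2%:E * (F (x 0%N) - Fstar))
       * ((2 * beta * k.+1%:R)^-1)%:E)%E.
Proof.
move=> F Fstar k.
have [dom_x0 [xt [v [eps run]]]] := x_gen.
have /andP[alpha0 _] := alpha_itv.
pose Fr := fin_objective f g.
have FE w : effective_domain g w -> F w = (Fr w)%:E by exact: objective_finE.
have beta_itv j : 0 <= beta_ j <= 1.
  have [_ _ [i [-> _ _]] _] := run j.
  have /andP[theta0 theta1] := theta_itv.
  by rewrite exprn_ge0 ?(ltW theta0)// exprn_ile1 ?ltW.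
have step j z : effective_domain g (x j) -> effective_domain g z ->
    effective_domain g (x j.+1) /\
    2 * (Fr (x j.+1) - Fr z) + `|x j.+1 - z| ^+ 2 <=
    2 * (1 - beta_ j) * (Fr (x j) - Fr z) + `|x j - z| ^+ 2.
  move=> dom_xj dom_z; have [prox _ [i [bE test _]] ->] := run j.
  rewrite -bE in test; apply: ipg_els_step_le prox test dom_xj dom_z => //.
  by have [] := f_C1.
have dom_x j : effective_domain g (x j).
  by elim: j => // j dom_xj; have [] := step j (x 0%N) dom_xj dom_x0.
have Fr_dec j : Fr (x j.+1) <= Fr (x j).
  have [_] := step j (x j) (dom_x j) (dom_x j).
  rewrite !subrr normr0 expr0n/= mulr0 addr0.
  by have := sqr_ge0 `|x j.+1 - x j|; move=> *; lra.
have dom_min s : minimizers F s -> effective_domain g s.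
  move=> /(_ (x 0%N)); rewrite (FE (x 0%N))// => Fs_le.
  rewrite /effective_domain/= ltey; apply/eqP => gs.
  by move: Fs_le; rewrite /F /objective gs addey.
have FstarE s : minimizers F s -> Fstar = (Fr s)%:E.
  move=> min_s; rewrite -FE; last exact: dom_min.
  apply/eqP; rewrite eq_le; apply/andP; split.
    by apply: ereal_inf_lbound; exists s.
  by apply/ereal_infP => _ [w _ <-]; exact: min_s.
have [s0 min_s0] := F_argmin.
rewrite (FstarE _ min_s0) !FE// -!(EFinB, EFinM, EFinD) lee_fin.
rewrite ler_pdivlMr ?mulr_gt0 ?ltr0n// -lerBlDr.
apply: sqr_distance_ge => // s min_s.
have Fs : Fr s = Fr s0 by apply: EFin_inj; rewrite -(FstarE _ min_s) -(FstarE _ min_s0).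
rewrite lerBlDr -Fs mulrC.
apply: (@telescoping_rate _ (fun j => Fr (x j) - Fr s)
  (fun j => `|x j - s| ^+ 2) beta_ _ (ltW beta_gt0)) => // j.
- by rewrite subr_ge0 -lee_fin -(FE _ (dom_min _ min_s)) -FE//; exact: min_s.
- by rewrite lerB.
- by have [] := step j s (dom_x j) (dom_min _ min_s).
Qed.
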